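(* Let $f:\mathbb{R}^n\to\mathbb{R}$ be convex with nonempty set of minimizers $X^*$, let $f^*=\min_{x\in\mathbb{R}^n} f(x)$, let $\overline{x}\in\mathbb{R}^n$ be a given initial point, and let $D^*=\min\{\|\overline{x}-x\|:x\in X^*\}$. Suppose that the number of evaluations of $f'$ in one call to $\mathcal{A}(\overline{x},R,\epsilon)$ is bounded by $$\frac{C_1(\overline{x},R,f)R^{\alpha_1}}{\epsilon^{\beta_1}}+\frac{C_2(\overline{x},R,f)R^{\alpha_2}}{\epsilon^{\beta_2}},$$ where $\alpha_1\ge\beta_1>0$, $\alpha_2\ge\beta_2>0$ and $C_1(\overline{x},R,f),C_2(\overline{x},R,f)$ are some constants that depend on $f$. Denote $\epsilon_k:=f(\overline{x}_k^* )-f^*$ for the iterates $\{\overline{x}_k^*\}$ of the algorithm described in the context. Then: (a) $r_k<2D^*$ for all $k$; (b) $\lim_{k\to\infty}\epsilon_k=0$; (c) the total number of evaluations of $f'$ performed by the algorithm up to the $k$-th iteration is bounded by $$\mathcal{O}\left(\frac{C_1(\overline{x},4D^*,f)(D^* )^{\alpha_1}}{\epsilon_k^{\beta_1}}+\frac{C_2(\overline{x},4D^*,f)(D^* )^{\alpha_2}}{\epsilon_k^{\beta_2}}\right).$$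
   Context: $\|\cdot\|$ is the Euclidean norm, $f'(x)\in\partial f(x)$ denotes a subgradient of $f$ at $x$, and $B(\overline{x},R)=\{x\in\mathbb{R}^n:\|x-\overline{x}\|\le R\}$. Put $h(z,x):=f(z)+\langle f'(z),x-z\rangle$. Oracle: for $R>0$ and $\epsilon>0$, $\mathcal{A}(\overline{x},R,\epsilon)$ is a first-order algorithm such that each call computes a point $z\in B(\overline{x},R)$ with $f(z)-\min_{x\in B(\overline{x},R)}f(x)\le\epsilon$. Algorithm (for the unconstrained problem $\min_{x\in\mathbb{R}^n}f(x)$). Choose an initial estimate $r_0\le D^*$ and compute the initial gap $\Delta_0:=f(\overline{x})-\min_{x\in B(\overline{x},r_0)}h(\overline{x},x)$. For $k=0,1,2,\ldots$: 1. Set $\overline{x}_k'=\mathcal{A}(\overline{x},r_k,\Delta_k)$ and $\overline{x}_k''=\mathcal{A}(\overline{x},2r_k,\Delta_k)$. 2. If $f(\overline{x}_k')-f(\overline{x}_k'')>\Delta_k$, update $r_k\leftarrow 2r_k$ and go to step 1. 3. Otherwise, let $\overline{x}_k^*=\overline{x}_k''$, $\Delta_{k+1}=\Delta_k/2$ and $r_{k+1}=r_k$.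
   Formalization: C_1(x̄,R,f) and C_2(x̄,R,f) are assumed nonnegative and nondecreasing in R (else (c) fails, e.g. if they vanish only at R=4D* ); the evaluation of f' at x̄ for Δ_0 is counted in (c) only when every oracle call evaluates f' at least once. *)

(* Defs.v *)
From HB Require Import structures.
From mathcomp Require Import all_boot all_order all_algebra.
From mathcomp Require Import all_classical all_reals all_analysis.

Set Implicit Arguments.
Unset Strict Implicit.
Unset Printing Implicit Defensive.

Import Order.TTheory GRing.Theory Num.Theory.
Import numFieldNormedType.Exports.

Local Open Scope classical_set_scope.
Local Open Scope ring_scope.

(* The library norm on 'rV[R]_n is the sup norm, hence the Euclidean one here. *)
Definition dotp (R : realType) (n : nat) (u v : 'rV[R]_n) : R :=
  \sum_(i < n) u 0 i * v 0 i.

Definition enorm (R : realType) (n : nat) (u : 'rV[R]_n) : R :=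
  Num.sqrt (dotp u u).

Definition eball (R : realType) (n : nat) (c : 'rV[R]_n) (r : R) :
  set 'rV[R]_n := [set x | enorm (x - c) <= r].

Definition convex_fun (R : realType) (n : nat) (f : 'rV[R]_n -> R) : Prop :=
  convex_function (setT : set (convex_lmodType 'rV[R]_n)) f.

(* [f'] selects a subgradient of [f] at every point. *)
Definition is_subgradient_selection (R : realType) (n : nat)
    (f : 'rV[R]_n -> R) (f' : 'rV[R]_n -> 'rV[R]_n) : Prop :=
  forall z x, f z + dotp (f' z) (x - z) <= f x.

Definition lin (R : realType) (n : nat) (f : 'rV[R]_n -> R)
    (f' : 'rV[R]_n -> 'rV[R]_n) (z x : 'rV[R]_n) : R :=
  f z + dotp (f' z) (x - z).

(* [inf] is used for every minimum: those below are all attained when [f] is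
   convex with a minimizer and the balls have positive radius. *)
Definition min_over (R : realType) (T : Type) (S : set T) (g : T -> R) : R :=
  inf (g @` S).

Definition argmin (R : realType) (n : nat) (f : 'rV[R]_n -> R) :
  set 'rV[R]_n := [set x | forall y, f x <= f y].

Definition fstar (R : realType) (n : nat) (f : 'rV[R]_n -> R) : R :=
  min_over setT f.

Definition Dstar (R : realType) (n : nat) (f : 'rV[R]_n -> R)
    (xbar : 'rV[R]_n) : R :=
  min_over (argmin f) (fun x => enorm (xbar - x)).

(* A first-order algorithm: an adaptive sequence of evaluations of [f] and of
   [f'], each chosen from the previous answers, ending with an output point. *)
Inductive fo_method (R : realType) (n : nat) : Type :=
| Output (z : 'rV[R]_n)
| EvalFun (y : 'rV[R]_n) (next : R -> fo_method R n)
| EvalGrad (y : 'rV[R]_n) (next : 'rV[R]_n -> fo_method R n).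

Fixpoint fo_output (R : realType) (n : nat) (f : 'rV[R]_n -> R)
    (f' : 'rV[R]_n -> 'rV[R]_n) (p : fo_method R n) : 'rV[R]_n :=
  match p with
  | Output z => z
  | EvalFun y next => fo_output f f' (next (f y))
  | EvalGrad y next => fo_output f f' (next (f' y))
  end.

(* Only the evaluations of [f'] are counted. *)
Fixpoint grad_evals (R : realType) (n : nat) (f : 'rV[R]_n -> R)
    (f' : 'rV[R]_n -> 'rV[R]_n) (p : fo_method R n) : nat :=
  match p with
  | Output _ => 0
  | EvalFun y next => grad_evals f f' (next (f y))
  | EvalGrad y next => (grad_evals f f' (next (f' y))).+1
  end.

Definition is_ball_oracle (R : realType) (n : nat) (f : 'rV[R]_n -> R)
    (f' : 'rV[R]_n -> 'rV[R]_n) (xbar : 'rV[R]_n)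
    (A : 'rV[R]_n -> R -> R -> fo_method R n) : Prop :=
  forall r eps : R, 0 < r -> 0 < eps ->
    let z := fo_output f f' (A xbar r eps) in
    eball xbar r z /\ f z - min_over (eball xbar r) f <= eps.

(* One alg_state per execution of Step 1: the iteration index k and the current
   values of r_k and Delta_k.  Both outcomes of the test (doubling the radius
   within iteration k, or passing to iteration k + 1) are transitions, so
   termination of the inner loop is not built in. *)
Record alg_state (R : realType) : Type :=
  State { st_iter : nat; st_radius : R; st_gap : R }.

Definition point1 (R : realType) (n : nat) (f : 'rV[R]_n -> R)
    (f' : 'rV[R]_n -> 'rV[R]_n) (A : 'rV[R]_n -> R -> R -> fo_method R n)
    (xbar : 'rV[R]_n) (s : alg_state R) : 'rV[R]_n :=
  fo_output f f' (A xbar (st_radius s) (st_gap s)).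

Definition point2 (R : realType) (n : nat) (f : 'rV[R]_n -> R)
    (f' : 'rV[R]_n -> 'rV[R]_n) (A : 'rV[R]_n -> R -> R -> fo_method R n)
    (xbar : 'rV[R]_n) (s : alg_state R) : 'rV[R]_n :=
  fo_output f f' (A xbar (2 * st_radius s) (st_gap s)).

Definition must_double (R : realType) (n : nat) (f : 'rV[R]_n -> R)
    (f' : 'rV[R]_n -> 'rV[R]_n) (A : 'rV[R]_n -> R -> R -> fo_method R n)
    (xbar : 'rV[R]_n) (s : alg_state R) : bool :=
  st_gap s < f (point1 f f' A xbar s) - f (point2 f f' A xbar s).

Definition alg_step (R : realType) (n : nat) (f : 'rV[R]_n -> R)
    (f' : 'rV[R]_n -> 'rV[R]_n) (A : 'rV[R]_n -> R -> R -> fo_method R n)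
    (xbar : 'rV[R]_n) (s : alg_state R) : alg_state R :=
  if must_double f f' A xbar s
  then State (st_iter s) (2 * st_radius s) (st_gap s)
  else State (st_iter s).+1 (st_radius s) (st_gap s / 2).

Definition alg_init (R : realType) (n : nat) (f : 'rV[R]_n -> R)
    (f' : 'rV[R]_n -> 'rV[R]_n) (xbar : 'rV[R]_n) (r0 : R) : alg_state R :=
  State 0 r0 (f xbar - min_over (eball xbar r0) (lin f f' xbar)).

Definition alg_run (R : realType) (n : nat) (f : 'rV[R]_n -> R)
    (f' : 'rV[R]_n -> 'rV[R]_n) (A : 'rV[R]_n -> R -> R -> fo_method R n)
    (xbar : 'rV[R]_n) (r0 : R) (j : nat) : alg_state R :=
  iter j (alg_step f f' A xbar) (alg_init f f' xbar r0).

(* The j-th execution of Step 1 is the one that ends iteration k; there is at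
   most one such j for each k. *)
Definition completes (R : realType) (n : nat) (f : 'rV[R]_n -> R)
    (f' : 'rV[R]_n -> 'rV[R]_n) (A : 'rV[R]_n -> R -> R -> fo_method R n)
    (xbar : 'rV[R]_n) (r0 : R) (j k : nat) : Prop :=
  st_iter (alg_run f f' A xbar r0 j) = k /\
  ~~ must_double f f' A xbar (alg_run f f' A xbar r0 j).

(* Equals epsilon_k when [j] completes iteration k. *)
Definition opt_gap (R : realType) (n : nat) (f : 'rV[R]_n -> R)
    (f' : 'rV[R]_n -> 'rV[R]_n) (A : 'rV[R]_n -> R -> R -> fo_method R n)
    (xbar : 'rV[R]_n) (r0 : R) (j : nat) : R :=
  f (point2 f f' A xbar (alg_run f f' A xbar r0 j)) - fstar f.

(* Evaluations of [f'] in all calls to the oracle made in the executions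
   0, ..., j of Step 1. *)
Definition oracle_evals (R : realType) (n : nat) (f : 'rV[R]_n -> R)
    (f' : 'rV[R]_n -> 'rV[R]_n) (A : 'rV[R]_n -> R -> R -> fo_method R n)
    (xbar : 'rV[R]_n) (r0 : R) (j : nat) : nat :=
  (\sum_(i < j.+1)
    (grad_evals f f' (A xbar (st_radius (alg_run f f' A xbar r0 i))
                             (st_gap (alg_run f f' A xbar r0 i)))
     + grad_evals f f' (A xbar (2 * st_radius (alg_run f f' A xbar r0 i))%R
                               (st_gap (alg_run f f' A xbar r0 i)))))%N.

(* Main.v *)
Require Import Defs.
From mathcomp Require Import all_boot all_order all_algebra.
From mathcomp Require Import all_classical all_reals all_analysis.
From mathcomp Require Import ring lra.
Import Order.TTheory GRing.Theory Num.Theory.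
Import numFieldNormedType.Exports.
Local Open Scope classical_set_scope.
Local Open Scope ring_scope.

(** Write [D] for the distance from [xbar] to the minimizers, and [r], [d] for
    the current radius and gap.  Each transition of the algorithm either
    doubles [r] or halves [d].

    The radius stays below [2 D]: as soon as [r >= D], the output on the ball
    of radius [r] is within [d] of the global minimum ([oracle_optimal]), so
    passing to radius [2 r] cannot gain more than [d] and no doubling occurs.
    As [r] starts positive, only finitely many doublings happen and every
    iteration terminates ([iteration_terminates]).

    When an iteration ends, the values on the balls of radius [r] and [2 r]
    differ by little, and convexity extrapolates this flatness up to a
    minimizer: the accuracy satisfies [eps * r <= 2 * D * d]
    ([gap_mul_radius_le]).  Since [r >= r0] and [d] is halved at every
    iteration, [eps] tends to 0.

    For the cost, the weight [r `^ a / d `^ b] is multiplied by [2 `^ a] or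
    [2 `^ b] at each transition, hence by at least [2 `^ b] because [b <= a].
    The sum over the whole run is thus dominated by its last term
    ([weight_sum_le]).  That term is controlled by the accuracy estimate: the
    loss [(2 D / r) `^ b] incurred on replacing [d] by [eps] is absorbed by
    [r `^ a], again because [b <= a], turning it into [D `^ a] up to the factor
    [2 `^ a] ([weight_le_accuracy]).  This is why the constant is independent
    of [r0], however small [r0 / D] is. *)

(** * Euclidean geometry *)

Section EuclideanNorm.
Context {R : realType} {n : nat}.
Implicit Types u v w x y c : 'rV[R]_n.

Lemma dotpC u v : dotp u v = dotp v u.
Proof. by apply: eq_bigr => i _; rewrite mulrC. Qed.

Lemma dotp_linearl (a b : R) u v w :
  dotp (a *: u + b *: v) w = a * dotp u w + b * dotp v w.
Proof.
rewrite /dotp !mulr_sumr -big_split /=; apply: eq_bigr => i _.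
by rewrite !mxE; ring.
Qed.

Lemma dotp_linearr (a b : R) u v w :
  dotp u (a *: v + b *: w) = a * dotp u v + b * dotp u w.
Proof. by rewrite dotpC dotp_linearl !(dotpC u). Qed.

Lemma dotpZr (a : R) u v : dotp u (a *: v) = a * dotp u v.
Proof. by rewrite /dotp mulr_sumr; apply: eq_bigr => i _; rewrite mxE; ring. Qed.

Lemma dotpNr u v : dotp u (- v) = - dotp u v.
Proof. by rewrite -scaleN1r dotpZr mulN1r. Qed.

Lemma dotpp_ge0 u : 0 <= dotp u u.
Proof. by apply: sumr_ge0 => i _; rewrite -expr2 sqr_ge0. Qed.

Lemma enorm_ge0 u : 0 <= enorm u. Proof. exact: sqrtr_ge0. Qed.

Lemma sqr_enorm u : enorm u ^+ 2 = dotp u u.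
Proof. exact/sqr_sqrtr/dotpp_ge0. Qed.

Lemma enorm_eq0 u : enorm u = 0 -> u = 0.
Proof.
move=> u0; have := sqr_enorm u; rewrite u0 expr0n /= => /esym /eqP.
rewrite psumr_eq0 => [/allP h|i _]; last by rewrite -expr2 sqr_ge0.
apply/rowP => i; have := h i (mem_index_enum i); rewrite mulf_eq0 orbb mxE.
by move/eqP.
Qed.

Lemma enorm0 : enorm (0 : 'rV[R]_n) = 0.
Proof. by rewrite /enorm /dotp big1 ?sqrtr0// => i _; rewrite mxE mul0r. Qed.

Lemma enormZ (a : R) u : enorm (a *: u) = `|a| * enorm u.
Proof.
rewrite /enorm -sqrtr_sqr -sqrtrM ?sqr_ge0//; congr Num.sqrt.
by rewrite /dotp mulr_sumr; apply: eq_bigr => i _; rewrite !mxE; ring.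
Qed.

(** The Cauchy-Schwarz inequality: expand the square of the vector
    [enorm v *: u - enorm u *: v]. *)
Lemma dotp_le_enorm u v : dotp u v <= enorm u * enorm v.
Proof.
have [u0|u0] := eqVneq (enorm u) 0.
  rewrite u0 mul0r (enorm_eq0 _ u0) /dotp big1// => i _.
  by rewrite mxE mul0r.
have [v0|v0] := eqVneq (enorm v) 0.
  rewrite v0 mulr0 (enorm_eq0 _ v0) /dotp big1// => i _.
  by rewrite mxE mulr0.
have uv0 : 0 < enorm u * enorm v.
  by rewrite mulr_gt0// lt_def ?u0 ?v0 enorm_ge0.
have := dotpp_ge0 (enorm v *: u + (- enorm u) *: v).
rewrite dotp_linearl !dotp_linearr -!sqr_enorm (dotpC v u) => h.
rewrite -subr_ge0 -(pmulr_rge0 _ uv0); nra.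
Qed.

Lemma enorm_triangle u v : enorm (u + v) <= enorm u + enorm v.
Proof.
have le0 : 0 <= enorm u + enorm v by rewrite addr_ge0 ?enorm_ge0.
rewrite -(ler_pXn2r (n := 2)) ?nnegrE ?enorm_ge0//.
rewrite sqr_enorm -[u]scale1r -[v]scale1r dotp_linearl !dotp_linearr.
rewrite !scale1r (dotpC v u) -!sqr_enorm.
have := dotp_le_enorm u v; nra.
Qed.

Lemma enorm_distC u v : enorm (u - v) = enorm (v - u).
Proof. by rewrite -opprB -scaleN1r enormZ normrN1 mul1r. Qed.

(** Balls are convex, in the quantitative form used to move points towards a
    minimizer lying outside a ball. *)
Lemma enorm_segment (t : R) c x y : 0 <= t <= 1 ->
  enorm (t *: x + (1 - t) *: y - c)
    <= t * enorm (x - c) + (1 - t) * enorm (y - c).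
Proof.
move=> /andP[t0 t1].
rewrite (_ : _ - c = t *: (x - c) + (1 - t) *: (y - c)); last first.
  by apply/rowP => i; rewrite !mxE; ring.
apply: le_trans (enorm_triangle _ _) _.
by rewrite !enormZ !ger0_norm ?subr_ge0.
Qed.

End EuclideanNorm.

(** * Minima and convex functions *)

Lemma min_over_le {R : realType} {T : Type} (S : set T) (g : T -> R) (m : R)
    (x : T) :
  (forall y, S y -> m <= g y) -> S x -> min_over S g <= g x.
Proof.
move=> mg Sx; apply: ge_inf; last by exists x.
by exists m => _ [y Sy <-]; exact: mg.
Qed.

Lemma le_min_over {R : realType} {T : Type} (S : set T) (g : T -> R) (m : R) :
  S !=set0 -> (forall y, S y -> m <= g y) -> m <= min_over S g.
Proof.
move=> [x Sx] mg; apply: lb_le_inf; first by exists (g x), x.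
by move=> _ [y Sy <-]; exact: mg.
Qed.

Section ConvexFunctions.
Context {R : realType} {n : nat}.
Context (f : 'rV[R]_n -> R).
Implicit Types x y z : 'rV[R]_n.

Lemma convex_fun_segment (t : R) x y : convex_fun f -> 0 <= t <= 1 ->
  f (t *: x + (1 - t) *: y) <= t * f x + (1 - t) * f y.
Proof.
move=> cf /andP[t0 t1].
by apply: (cf (Itv01 t0 t1) x y); rewrite inE.
Qed.

Lemma fstarE x : argmin f x -> fstar f = f x.
Proof.
move=> xf; apply/eqP; rewrite eq_le; apply/andP; split.
  by apply: (@min_over_le _ _ _ _ (f x)) => // y _; exact: xf.
by apply: le_min_over => [|y _]; [exists x|exact: xf].
Qed.

Lemma Dstar_le xbar x : argmin f x -> Dstar f xbar <= enorm (x - xbar).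
Proof.
move=> xf; rewrite enorm_distC.
by apply: (@min_over_le _ _ _ _ 0) => // y _; exact: enorm_ge0.
Qed.

(** Upper bounds in terms of [Dstar] are obtained by proving them with the
    distance of an arbitrary minimizer in place of [Dstar]; no projection onto
    the set of minimizers has to be constructed. *)
Lemma le_Dstar xbar (m : R) : argmin f !=set0 ->
  (forall x, argmin f x -> m <= enorm (x - xbar)) -> m <= Dstar f xbar.
Proof.
by move=> f0 h; apply: le_min_over => // x /h; rewrite enorm_distC.
Qed.

End ConvexFunctions.

(** * Power weights and geometric sums *)

Section PowerWeights.
Context {R : realType}.

Lemma powR2_gt1 (b : R) : 0 < b -> 1 < 2 `^ b.
Proof.
move=> b0; have := @gt0_ltr_powR R b b0 1 2.
rewrite /= powR1; apply; rewrite ?nnegrE ?ler01 ?ler0n ?ltr1n//.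
Qed.

Lemma weight_double (a b r e : R) : 0 <= r ->
  (2 * r) `^ a / e `^ b = 2 `^ a * (r `^ a / e `^ b).
Proof. by move=> r0; rewrite powRM// mulrA. Qed.

Lemma weight_halve (a b r e : R) : 0 < e ->
  r `^ a / (e / 2) `^ b = 2 `^ b * (r `^ a / e `^ b).
Proof.
move=> e0; have e20 : 0 < e / 2 by rewrite divr_gt0.
have -> : e `^ b = (e / 2) `^ b * 2 `^ b.
  by rewrite -powRM ?divfK// ltW.
by field; rewrite !gt_eqF// powR_gt0.
Qed.

(** Terms growing at least by the factor [c] are, read backwards, below a
    geometric series of ratio [c^-1] and sum [c / (c - 1)]. *)
Lemma geometric_sum_le (c : R) (w : nat -> R) (j : nat) :
  1 < c -> (forall i, 0 <= w i) -> (forall i, c * w i <= w i.+1) ->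
  \sum_(i < j.+1) w i <= c / (c - 1) * w j.
Proof.
move=> c1 w0 wS; have c10 : 0 < c - 1 by rewrite subr_gt0.
have cq : c / (c - 1) = 1 + (c - 1)^-1 by field; rewrite gt_eqF.
elim: j => [|j IH].
  rewrite big_ord_recr big_ord0 /= add0r cq ler_peMl// lerDl invr_ge0.
  exact: ltW.
rewrite big_ord_recr /= [X in _ <= X * _]cq mulrDl mul1r addrC lerD2l.
apply: le_trans IH _.
by rewrite -mulrA mulrCA ler_wpM2l ?invr_ge0// ltW.
Qed.

(** Split [r `^ a] as [r `^ (a - b) * r `^ b]: the second factor turns
    [e `^ b] into [(e * r) `^ b <= (2 * D * d) `^ b], and the first is at most
    [(2 * D) `^ (a - b)]. *)
Lemma weight_le_accuracy (a b r d D e : R) : 0 < b -> b <= a ->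
  0 < r -> r < 2 * D -> 0 < d -> 0 < e -> e * r <= 2 * D * d ->
  r `^ a / d `^ b <= 2 `^ a * (D `^ a / e `^ b).
Proof.
move=> b0 ba r0 rD d0 e0 er.
have D0 : 0 < D by lra.
have aE (x : R) : 0 < x -> x `^ a = x `^ (a - b) * x `^ b.
  by move=> x0; rewrite -powRD ?subrK// (gt_eqF x0) implybT.
have D2 : 0 < 2 * D by lra.
rewrite mulrA -powRM ?(ltW D0)// ler_pdivrMr ?powR_gt0// mulrAC.
rewrite ler_pdivlMr ?powR_gt0// (aE _ r0) (aE _ D2).
rewrite -!mulrA ler_pM ?mulr_ge0 ?powR_ge0//.
  by apply: ge0_ler_powR; rewrite ?nnegrE ?subr_ge0//; lra.
rewrite -!powRM ?(ltW r0) ?(ltW e0) ?(ltW d0) ?(ltW D2)//.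
apply: ge0_ler_powR; rewrite ?nnegrE; nra.
Qed.

End PowerWeights.

(** * Minimization over balls *)

Section RestrictedMinimization.
Context {R : realType} {n : nat}.
Context (f : 'rV[R]_n -> R) (f' : 'rV[R]_n -> 'rV[R]_n) (xbar : 'rV[R]_n).
Context (A : 'rV[R]_n -> R -> R -> fo_method R n).
Hypothesis f_convex : convex_fun f.
Hypothesis f_min : argmin f !=set0.
Hypothesis A_oracle : is_ball_oracle f f' xbar A.

Let fs := fstar f.
Let D := Dstar f xbar.
Let out r e := fo_output f f' (A xbar r e).

Lemma fstar_le x : fs <= f x.
Proof. by case: f_min => y yf; rewrite /fs (fstarE _ _ yf). Qed.

Lemma oracle_in_ball r e : 0 < r -> 0 < e -> enorm (out r e - xbar) <= r.
Proof. by move=> r0 e0; have [] := A_oracle r e r0 e0. Qed.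

Lemma oracle_le r e y : 0 < r -> 0 < e -> enorm (y - xbar) <= r ->
  f (out r e) <= f y + e.
Proof.
move=> r0 e0 yr; have [_ h] := A_oracle r e r0 e0.
have : min_over (eball xbar r) f <= f y.
  by apply: (min_over_le _ _ fs) => // z _; exact: fstar_le.
rewrite /out; lra.
Qed.

(** The infimum [D] is approached by minimizers that may all lie slightly
    outside the ball, so a minimizer at distance [d > r] is pulled back along
    the segment to [xbar] until it enters the ball.  If the output missed the
    accuracy [e], this would keep every minimizer at a distance from [xbar]
    exceeding [r] by a fixed amount, contradicting [D <= r]. *)
Lemma oracle_optimal r e : 0 < r -> 0 < e -> D <= r -> f (out r e) <= fs + e.
Proof.
move=> r0 e0 Dr; rewrite leNgt; apply/negP => bad.
have center : f (out r e) <= f xbar + e.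
  by apply: oracle_le => //; rewrite subrr enorm0 ltW.
set eta := f (out r e) - e - fs; set G := f xbar - fs.
have eta0 : 0 < eta by rewrite /eta; lra.
have G0 : 0 < G by rewrite /G; lra.
have : r + r * eta / G <= D.
  apply: le_Dstar => // x xf; set d := enorm (x - xbar).
  have fx : f x = fs by rewrite /fs (fstarE _ _ xf).
  have [dr|rd] := leP d r.
    have := oracle_le r e x r0 e0 dr; rewrite fx; lra.
  have d0 : 0 < d by lra.
  have t01 : 0 <= r / d <= 1.
    by rewrite divr_ge0 ?(ltW r0) ?(ltW d0)//= ler_pdivrMr// mul1r ltW.
  have inball : enorm ((r / d) *: x + (1 - r / d) *: xbar - xbar) <= r.
    apply: le_trans (enorm_segment _ _ _ _ t01) _.
    by rewrite subrr enorm0 mulr0 addr0 -/d divfK// gt_eqF.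
  have h1 := oracle_le r e _ r0 e0 inball.
  have h2 := convex_fun_segment _ _ x xbar f_convex t01.
  have key : eta <= (1 - r / d) * G by rewrite /eta /G; rewrite fx in h2; lra.
  have : r * eta <= (d - r) * G.
    apply: (@le_trans _ _ (d * eta)); first by rewrite ler_wpM2r// ltW.
    have -> : (d - r) * G = d * ((1 - r / d) * G) by field; rewrite gt_eqF.
    by rewrite ler_wpM2l// ltW.
  by rewrite -ler_pdivrMr// lerBrDl.
apply/negP; rewrite -ltNge; apply: (le_lt_trans Dr).
by rewrite ltrDl !mulr_gt0// invr_gt0.
Qed.

(** If doubling the radius gains little, then nothing much can be gained
    further out: with a minimizer [x] at distance [d > 2 r], a convex
    combination of [x] and of the output on the ball of radius [r] lies in the
    ball of radius [2 r], where it cannot beat the other output by more than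
    [e].  The factor [d / r] left in the bound is the extrapolation ratio. *)
Lemma gap_mul_radius_le r e : 0 < r -> r < 2 * D -> 0 < e ->
  f (out r e) - f (out (2 * r) e) <= e ->
  (f (out (2 * r) e) - fs) * r <= 2 * D * e.
Proof.
move=> r0 rD e0 small; set F := f (out (2 * r) e).
have r20 : 0 < 2 * r by lra.
rewrite mulrAC [2 * e]mulrC -ler_pdivrMl ?mulr_gt0//.
apply: le_Dstar => // x xf; set d := enorm (x - xbar).
have fx : f x = fs by rewrite /fs (fstarE _ _ xf).
have Dd : D <= d by exact: Dstar_le.
rewrite ler_pdivrMl ?mulr_gt0//.
have [d2|d2] := leP d (2 * r).
  have := oracle_le (2 * r) e x r20 e0 d2; rewrite fx -/F => FE.
  apply: (@le_trans _ _ (e * r)); first by rewrite ler_wpM2r ?(ltW r0)//; lra.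
  nra.
have dr0 : 0 < d - r by lra.
(* The weight [t] solves [t * r + (1 - t) * d = 2 * r]. *)
set t := (d - 2 * r) / (d - r).
have tE : t * (d - r) = d - 2 * r by rewrite /t divfK// gt_eqF.
have t01 : 0 <= t <= 1.
  by rewrite /t divr_ge0 ?ler_pdivrMr ?mul1r//=; lra.
have inball : enorm (t *: out r e + (1 - t) *: x - xbar) <= 2 * r.
  apply: le_trans (enorm_segment _ _ _ _ t01) _; rewrite -/d.
  have := oracle_in_ball r e r0 e0 => zr.
  case/andP: t01 => t0 _; nra.
have h1 := oracle_le (2 * r) e _ r20 e0 inball.
have h2 := convex_fun_segment _ t (out r e) x f_convex t01.
rewrite -/F in h1 small; rewrite fx in h2.
have key : (1 - t) * (F - fs) <= (1 + t) * e.
  case/andP: t01 => t0 _; nra.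
have -> : (F - fs) * r = (d - r) * ((1 - t) * (F - fs)).
  have -> : (d - r) * ((1 - t) * (F - fs)) = (d - r - t * (d - r)) * (F - fs).
    by ring.
  by rewrite tE; ring.
apply: (@le_trans _ _ ((d - r) * ((1 + t) * e))).
  by rewrite ler_wpM2l// ltW.
have -> : (d - r) * ((1 + t) * e) = (d - r + t * (d - r)) * e by ring.
rewrite tE; nra.
Qed.

End RestrictedMinimization.

(** * Radius, gap and accuracy along a run *)

Section AlgorithmRun.
Context {R : realType} {n : nat}.
Context (f : 'rV[R]_n -> R) (f' : 'rV[R]_n -> 'rV[R]_n) (xbar : 'rV[R]_n).
Context (r0 : R) (A : 'rV[R]_n -> R -> R -> fo_method R n).
Hypothesis f_convex : convex_fun f.
Hypothesis f_subgrad : is_subgradient_selection f f'.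
Hypothesis f_min : argmin f !=set0.
Hypothesis r0_gt0 : 0 < r0.
Hypothesis r0_le : r0 <= Dstar f xbar.
Hypothesis A_oracle : is_ball_oracle f f' xbar A.

Let D := Dstar f xbar.
Let run := alg_run f f' A xbar r0.
Let rad j := st_radius (run j).
Let gap j := st_gap (run j).

(** The linear model decreases strictly towards any minimizer, and [r0 <= D]
    lets one step of length [r0] in that direction stay in the ball. *)
Lemma initial_gap_gt0 : 0 < gap 0.
Proof.
rewrite /gap /run /= subr_gt0; case: f_min => x xf.
have Dx : D <= enorm (x - xbar) by exact: Dstar_le.
set d := enorm (x - xbar) in Dx.
have d0 : 0 < d by apply: lt_le_trans Dx; exact: lt_le_trans r0_le.
have decrease : dotp (f' xbar) (x - xbar) < 0.
  have := f_subgrad xbar x.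
  suff : f x < f xbar by lra.
  rewrite lt_neqAle xf andbT; apply/eqP => fE.
  have : argmin f xbar by move=> y; rewrite -fE; exact: xf.
  move/(Dstar_le _ xbar); rewrite subrr enorm0 leNgt.
  by rewrite (lt_le_trans r0_gt0 r0_le).
(* The point of the sphere of radius [r0] in the direction of [x]. *)
pose y := xbar + (r0 / d) *: (x - xbar).
have yb : y - xbar = (r0 / d) *: (x - xbar) by rewrite /y addrC addKr.
have yball : eball xbar r0 y.
  rewrite /eball /= yb enormZ ger0_norm ?divr_ge0 ?(ltW r0_gt0) ?(ltW d0)//.
  by rewrite -/d divfK// gt_eqF.
have yE : lin f f' xbar y < f xbar.
  by rewrite /lin yb dotpZr gtrDl pmulr_rlt0// divr_gt0.
apply: le_lt_trans yE.
(* The linear model is bounded below on the ball, by Cauchy-Schwarz. *)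
apply: (min_over_le _ _ (f xbar - enorm (f' xbar) * r0)) => // z zr.
rewrite /lin lerD2l lerNl -dotpNr opprB.
apply: le_trans (dotp_le_enorm _ _) _.
by rewrite ler_wpM2l ?enorm_ge0// enorm_distC.
Qed.

Lemma run_double j : must_double f f' A xbar (run j) ->
  run j.+1 = State (st_iter (run j)) (2 * rad j) (gap j).
Proof. by move=> h; rewrite /run /alg_run iterS /alg_step h. Qed.

Lemma run_advance j : ~~ must_double f f' A xbar (run j) ->
  run j.+1 = State (st_iter (run j)).+1 (rad j) (gap j / 2).
Proof. by move=> h; rewrite /run /alg_run iterS /alg_step (negbTE h). Qed.

Lemma rad_gt0 j : 0 < rad j.
Proof.
elim: j => // j IH; rewrite /rad.
have [/run_double|/run_advance] := boolP (must_double f f' A xbar (run j));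
  by move=> -> //=; rewrite mulr_gt0.
Qed.

Lemma gapE j : gap j = gap 0 / 2 ^+ st_iter (run j).
Proof.
elim: j => [|j IH]; first by rewrite /= expr0 divr1.
rewrite /gap; have [/run_double|/run_advance] :=
  boolP (must_double f f' A xbar (run j)); move=> -> //=.
by rewrite -/(gap j) IH exprSr invfM mulrA.
Qed.

Lemma gap_gt0 j : 0 < gap j.
Proof. by rewrite gapE divr_gt0 ?exprn_gt0// initial_gap_gt0. Qed.

(** Once the radius reaches [D], the oracle output is already within the gap of
    the optimal value, so there is nothing left to gain. *)
Lemma must_double_rad_lt j : must_double f f' A xbar (run j) -> rad j < D.
Proof.
move=> h; rewrite ltNge; apply/negP => Dr; move: h.
rewrite /must_double /point1 /point2 -/(rad j) -/(gap j) => h.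
have := oracle_optimal _ _ _ _ f_convex f_min A_oracle _ _
  (rad_gt0 j) (gap_gt0 j) Dr.
have := fstar_le f f_min (fo_output f f' (A xbar (2 * rad j) (gap j))).
lra.
Qed.

Lemma rad_lt j : rad j < 2 * D.
Proof.
have D0 : 0 < D by exact: lt_le_trans r0_le.
elim: j => [|j IH].
  by apply: le_lt_trans r0_le _; rewrite ltr_pMl// ltr1n.
rewrite /rad; have [dbl|adv] := boolP (must_double f f' A xbar (run j)).
  by rewrite run_double//= ltr_pM2l// must_double_rad_lt.
by rewrite run_advance.
Qed.

Lemma rad_ge j : r0 <= rad j.
Proof.
elim: j => // j IH; apply: le_trans IH _; have := rad_gt0 j.
rewrite {3}/rad; have [/run_double|/run_advance] :=
  boolP (must_double f f' A xbar (run j)); move=> -> /=; lra.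
Qed.

(** Doubling forever would make the radius unbounded. *)
Lemma iteration_terminates j : exists i,
  completes f f' A xbar r0 i (st_iter (run j)).
Proof.
apply: contrapT => never.
have iterE i : st_iter (run (j + i)) = st_iter (run j) /\
    rad (j + i) = 2 ^+ i * rad j.
  elim: i => [|i [IHk IHr]]; first by rewrite addn0 expr0 mul1r.
  have dbl : must_double f f' A xbar (run (j + i)).
    by apply/negPn/negP => adv; apply: never; exists (j + i)%N.
  by rewrite addnS {1}/rad run_double//= IHk IHr exprS mulrA.
pose N := Num.Def.archi_bound (2 * D / rad j).
have := @upper_nthrootP _ (2 * D / rad j) N (leqnn _).
rewrite ltr_pdivrMr ?rad_gt0// -(iterE N).2 ltNge.
by rewrite (ltW (rad_lt _)).
Qed.

Lemma completes_exists k : exists j, completes f f' A xbar r0 j k.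
Proof.
elim: k => [|k [j [jk adv]]]; first exact: (iteration_terminates 0).
have := iteration_terminates j.+1.
by rewrite run_advance//= -[st_iter (run j)]/(st_iter (alg_run _ _ _ _ _ _)) jk.
Qed.

Lemma opt_gap_ge0 j : 0 <= opt_gap f f' A xbar r0 j.
Proof. by rewrite subr_ge0 fstar_le. Qed.

Lemma opt_gap_mul_rad_le j k : completes f f' A xbar r0 j k ->
  opt_gap f f' A xbar r0 j * rad j <= 2 * D * gap j.
Proof.
move=> [_]; rewrite /must_double -leNgt => small.
exact: gap_mul_radius_le f_convex f_min A_oracle _ _
  (rad_gt0 j) (rad_lt j) (gap_gt0 j) small.
Qed.

Lemma opt_gap_cvg0 (J : nat -> nat) :
  (forall k, completes f f' A xbar r0 (J k) k) ->
  opt_gap f f' A xbar r0 (J k) @[k --> \oo] --> (0 : R).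
Proof.
move=> Jk.
apply: (squeeze_cvgr (f := fun=> 0)
  (h := geometric (2 * D * gap 0 / r0) 2^-1)).
- near=> k; rewrite opt_gap_ge0 /= mulrAC ler_pdivlMr//.
  apply: (@le_trans _ _ (opt_gap f f' A xbar r0 (J k) * rad (J k))).
    by rewrite ler_wpM2l ?opt_gap_ge0// rad_ge.
  apply: le_trans (opt_gap_mul_rad_le _ _ (Jk k)) _.
  by rewrite gapE (Jk k).1 exprVn !mulrA.
- exact: cvg_cst.
- by apply: cvg_geometric; rewrite ger0_norm ?invr_ge0// invf_lt1// ltr1n.
Unshelve. all: by end_near.
Qed.

(** Doubling the radius multiplies the weight by [2 `^ a], halving the gap
    multiplies it by [2 `^ b]; both factors are at least [2 `^ b > 1], so the
    last term dominates. *)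
Lemma weight_sum_le (a b : R) j : 0 < b -> b <= a ->
  \sum_(i < j.+1) rad i `^ a / gap i `^ b
    <= 2 `^ b / (2 `^ b - 1) * (rad j `^ a / gap j `^ b).
Proof.
move=> b0 ba; apply: geometric_sum_le (fun i => rad i `^ a / gap i `^ b) j _ _ _.
- exact: powR2_gt1.
- by move=> i; rewrite divr_ge0 ?powR_ge0.
move=> i; have [dbl|adv] := boolP (must_double f f' A xbar (run i)).
  rewrite /rad /gap run_double//= -/(rad i) -/(gap i) weight_double ?(ltW (rad_gt0 i))//.
  rewrite ler_wpM2r ?divr_ge0 ?powR_ge0//.
  by rewrite ler_powR// ler1n.
by rewrite /rad /gap run_advance//= -/(rad i) -/(gap i) weight_halve ?gap_gt0.
Qed.

Lemma completed_weight_sum_le (a b : R) j k : 0 < b -> b <= a ->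
  completes f f' A xbar r0 j k -> 0 < opt_gap f f' A xbar r0 j ->
  \sum_(i < j.+1) rad i `^ a / gap i `^ b
    <= 2 `^ b / (2 `^ b - 1) * 2 `^ a
       * (D `^ a / opt_gap f f' A xbar r0 j `^ b).
Proof.
move=> b0 ba jk e0; apply: le_trans (weight_sum_le _ _ _ b0 ba) _.
rewrite -[X in _ <= X]mulrA ler_wpM2l//.
  by rewrite divr_ge0 ?powR_ge0// subr_ge0 ltW// powR2_gt1.
apply: (weight_le_accuracy _ _ _ _ _ _ b0 ba
  (rad_gt0 j) (rad_lt j) (gap_gt0 j) e0).
exact: opt_gap_mul_rad_le jk.
Qed.

End AlgorithmRun.

(** * Complexity *)

(** The constant of the complexity bound: two oracle calls per transition, at
    radii [r] and [2 r], cost [1 + 2 `^ a] weights; the geometric sum over the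
    run contributes the ratio in the middle, and the passage from the
    gap to the accuracy contributes the last factor. *)
Definition complexity_constant (R : realType) (a b : R) : R :=
  (1 + 2 `^ a) * (2 `^ b / (2 `^ b - 1) * 2 `^ a).

Lemma complexity_constant_gt0 (R : realType) (a b : R) :
  0 < b -> 0 < complexity_constant R a b.
Proof.
move=> b0; rewrite /complexity_constant mulr_gt0 ?addr_gt0 ?powR_gt0//.
by rewrite mulr_gt0 ?divr_gt0 ?powR_gt0// subr_gt0 powR2_gt1.
Qed.

Section Complexity.
Context {R : realType} {n : nat}.
Context (f : 'rV[R]_n -> R) (f' : 'rV[R]_n -> 'rV[R]_n) (xbar : 'rV[R]_n).
Context (r0 : R) (A : 'rV[R]_n -> R -> R -> fo_method R n).
Context (C1 C2 : R -> R) (a1 b1 a2 b2 : R).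
Hypothesis f_convex : convex_fun f.
Hypothesis f_subgrad : is_subgradient_selection f f'.
Hypothesis f_min : argmin f !=set0.
Hypothesis r0_gt0 : 0 < r0.
Hypothesis r0_le : r0 <= Dstar f xbar.
Hypothesis A_oracle : is_ball_oracle f f' xbar A.
Hypothesis C_ge0 : forall r, 0 < r -> 0 <= C1 r /\ 0 <= C2 r.
Hypothesis C_mono : forall r r', 0 < r -> r <= r' -> C1 r <= C1 r' /\ C2 r <= C2 r'.
Hypothesis A_cost : forall r eps, 0 < r -> 0 < eps ->
  (grad_evals f f' (A xbar r eps))%:R
    <= C1 r * r `^ a1 / eps `^ b1 + C2 r * r `^ a2 / eps `^ b2.
Hypotheses (b1_gt0 : 0 < b1) (b1_le : b1 <= a1).
Hypotheses (b2_gt0 : 0 < b2) (b2_le : b2 <= a2).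

Let D := Dstar f xbar.
Let rad j := st_radius (alg_run f f' A xbar r0 j).
Let gap j := st_gap (alg_run f f' A xbar r0 j).
Let weight (a b : R) j := rad j `^ a / gap j `^ b.

Lemma step_evals_le j :
  (grad_evals f f' (A xbar (rad j) (gap j))
   + grad_evals f f' (A xbar (2 * rad j) (gap j)))%:R
  <= C1 (4 * D) * (1 + 2 `^ a1) * weight a1 b1 j
     + C2 (4 * D) * (1 + 2 `^ a2) * weight a2 b2 j.
Proof.
have r_gt0 : 0 < rad j by exact: rad_gt0.
have r2_gt0 : 0 < 2 * rad j by rewrite mulr_gt0.
have g_gt0 : 0 < gap j by exact: gap_gt0.
have r_lt : rad j < 2 * D by exact: rad_lt.
have [h1 h2] := (A_cost _ _ r_gt0 g_gt0, A_cost _ _ r2_gt0 g_gt0).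
have [c1 c2] : C1 (rad j) <= C1 (4 * D) /\ C2 (rad j) <= C2 (4 * D).
  by apply: C_mono => //; lra.
have [d1 d2] : C1 (2 * rad j) <= C1 (4 * D) /\ C2 (2 * rad j) <= C2 (4 * D).
  by apply: C_mono => //; lra.
rewrite -!mulrA !weight_double ?(ltW r_gt0)// -!/(weight _ _ _) in h1 h2.
have w1 : 0 <= weight a1 b1 j by rewrite divr_ge0 ?powR_ge0.
have w2 : 0 <= weight a2 b2 j by rewrite divr_ge0 ?powR_ge0.
have v1 : 0 <= 2 `^ a1 * weight a1 b1 j by rewrite mulr_ge0 ?powR_ge0.
have v2 : 0 <= 2 `^ a2 * weight a2 b2 j by rewrite mulr_ge0 ?powR_ge0.
have := ler_wpM2r w1 c1; have := ler_wpM2r w2 c2.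
have := ler_wpM2r v1 d1; have := ler_wpM2r v2 d2.
rewrite natrD; lra.
Qed.

Lemma oracle_evals_le j k :
  completes f f' A xbar r0 j k -> 0 < opt_gap f f' A xbar r0 j ->
  (oracle_evals f f' A xbar r0 j)%:R
  <= (complexity_constant R a1 b1 + complexity_constant R a2 b2)
     * (C1 (4 * D) * D `^ a1 / opt_gap f f' A xbar r0 j `^ b1
        + C2 (4 * D) * D `^ a2 / opt_gap f f' A xbar r0 j `^ b2).
Proof.
move=> jk eps_gt0; set eps := opt_gap f f' A xbar r0 j in eps_gt0 *.
have D4_gt0 : 0 < 4 * D by rewrite mulr_gt0// (lt_le_trans r0_gt0 r0_le).
have [c1 c2] := C_ge0 _ D4_gt0.
have total : (oracle_evals f f' A xbar r0 j)%:R
    <= C1 (4 * D) * (1 + 2 `^ a1) * \sum_(i < j.+1) weight a1 b1 i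
       + C2 (4 * D) * (1 + 2 `^ a2) * \sum_(i < j.+1) weight a2 b2 i.
  rewrite /oracle_evals natr_sum !mulr_sumr -big_split /=.
  by apply: ler_sum => i _; exact: step_evals_le.
apply: le_trans total _.
have term (c a b : R) : 0 <= c -> 0 < b -> b <= a ->
    c * (1 + 2 `^ a) * \sum_(i < j.+1) weight a b i
    <= complexity_constant R a b * (c * D `^ a / eps `^ b).
  move=> c0 b0 ba.
  have -> : complexity_constant R a b * (c * D `^ a / eps `^ b)
      = c * (1 + 2 `^ a)
        * (2 `^ b / (2 `^ b - 1) * 2 `^ a * (D `^ a / eps `^ b)).
    by rewrite /complexity_constant; ring.
  apply: ler_wpM2l; first by rewrite mulr_ge0 ?addr_ge0 ?powR_ge0.
  exact: completed_weight_sum_le jk eps_gt0.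
have B0 (c a b : R) : 0 <= c -> 0 <= c * D `^ a / eps `^ b.
  by move=> c0; rewrite divr_ge0 ?mulr_ge0 ?powR_ge0.
have K1 := complexity_constant_gt0 _ a1 _ b1_gt0.
have K2 := complexity_constant_gt0 _ a2 _ b2_gt0.
have := term _ _ _ c1 b1_gt0 b1_le; have := term _ _ _ c2 b2_gt0 b2_le.
have := mulr_ge0 (ltW K1) (B0 _ a2 b2 c2).
have := mulr_ge0 (ltW K2) (B0 _ a1 b1 c1).
lra.
Qed.

Lemma oracle_evals_gt0 j :
  (forall r e, 0 < r -> 0 < e -> (0 < grad_evals f f' (A xbar r e))%N) ->
  (0 < oracle_evals f f' A xbar r0 j)%N.
Proof.
move=> pos; rewrite /oracle_evals big_ord_recr /= !addn_gt0.
by rewrite [X in _ || (X || _)]pos ?orbT//; [exact: rad_gt0|exact: gap_gt0].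
Qed.

End Complexity.

(* The constant M hidden in the O(.) depends on the exponents only.
   C1 and C2 are nonnegative and nondecreasing in the radius.
   When epsilon_k = 0 the bound in (c) is +oo, hence the guard 0 < epsilon_k.
   The bound is given both for the oracle calls alone and, when no call is
   free, with the evaluation of f' at xbar used to compute Delta_0. *)
Theorem theorem2p2 (R : realType) (a1 b1 a2 b2 : R)
  (hb1 : 0 < b1) (hab1 : b1 <= a1) (hb2 : 0 < b2) (hab2 : b2 <= a2) :
  exists M : R, 0 < M /\
  forall (n : nat) (f : 'rV[R]_n -> R) (f' : 'rV[R]_n -> 'rV[R]_n)
    (xbar : 'rV[R]_n) (r0 : R)
    (A : 'rV[R]_n -> R -> R -> fo_method R n)
    (C1 C2 : 'rV[R]_n -> R -> ('rV[R]_n -> R) -> R),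
  convex_fun f ->
  is_subgradient_selection f f' ->
  argmin f !=set0 ->
  0 < r0 -> r0 <= Dstar f xbar ->
  is_ball_oracle f f' xbar A ->
  (forall r, 0 < r -> 0 <= C1 xbar r f /\ 0 <= C2 xbar r f) ->
  (forall r r', 0 < r -> r <= r' ->
     C1 xbar r f <= C1 xbar r' f /\ C2 xbar r f <= C2 xbar r' f) ->
  (forall r eps, 0 < r -> 0 < eps ->
     (grad_evals f f' (A xbar r eps))%:R
       <= C1 xbar r f * r `^ a1 / eps `^ b1
          + C2 xbar r f * r `^ a2 / eps `^ b2) ->
  (* (a) *)
  (forall j, st_radius (alg_run f f' A xbar r0 j) < 2 * Dstar f xbar) /\
  exists J : nat -> nat,
    (forall k, completes f f' A xbar r0 (J k) k) /\
    (* (b) *)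
    (opt_gap f f' A xbar r0 (J k) @[k --> \oo] --> (0 : R)) /\
    (* (c) *)
    (forall k, 0 < opt_gap f f' A xbar r0 (J k) ->
       let eps := opt_gap f f' A xbar r0 (J k) in
       let D := Dstar f xbar in
       let bound := C1 xbar (4 * D) f * D `^ a1 / eps `^ b1
                    + C2 xbar (4 * D) f * D `^ a2 / eps `^ b2 in
       (oracle_evals f f' A xbar r0 (J k))%:R <= M * bound /\
       ((forall r e, 0 < r -> 0 < e ->
           (0 < grad_evals f f' (A xbar r e))%N) ->
        (1 + oracle_evals f f' A xbar r0 (J k))%:R <= M * bound)).
Proof.
set K1 := complexity_constant R a1 b1; set K2 := complexity_constant R a2 b2.
have K_gt0 : 0 < K1 + K2 by rewrite addr_gt0 ?complexity_constant_gt0.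
exists (2 * (K1 + K2)); split; first by rewrite mulr_gt0.
move=> n f f' xbar r0 A C1 C2 cf sg f0 r0_gt0 r0_le orc C_ge0 C_mono A_cost.
split; first exact: rad_lt.
have [J JP] := choice (completes_exists f f' xbar r0 A cf sg f0 r0_gt0 r0_le orc).
exists J; split=> //; split; first exact: opt_gap_cvg0.
move=> k eps_gt0 eps D bound.
have le1 : (oracle_evals f f' A xbar r0 (J k))%:R <= (K1 + K2) * bound.
  exact: (oracle_evals_le f f' xbar r0 A (fun r => C1 xbar r f)
    (fun r => C2 xbar r f) _ _ _ _ cf sg f0 r0_gt0 r0_le orc C_ge0 C_mono
    A_cost hb1 hab1 hb2 hab2 _ k (JP k) eps_gt0).
have N0 : 0 <= (oracle_evals f f' A xbar r0 (J k))%:R :> R by rewrite ler0n.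
split; first by lra.
(* The factor 2 in the constant pays for the evaluation at [xbar], since the
   oracle calls count at least one evaluation. *)
move=> pos; have : 1 <= (oracle_evals f f' A xbar r0 (J k))%:R :> R.
  by rewrite ler1n; apply: oracle_evals_gt0.
rewrite natrD; lra.
Qed.
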